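(* Let $d\ge 1$, let $\mathcal{A}$ be a finite alphabet, and let $\mu$ be a stationary $\mathbb{Z}^d$ Markov random field on $\mathcal{A}^{\mathbb{Z}^d}$. Then for every positive integer $n$, $$H_\mu(\{\mathbf{0}\} \mid \partial S_n) \;\le\; h(\mu) \;\le\; H_\mu(\{\mathbf{0}\} \mid U_n).$$
   Context: $\mathbb{Z}^d$ is viewed as the graph in which $u,v$ are adjacent iff $\sum_{i=1}^d|u_i-v_i|=1$. For $S\subset\mathbb{Z}^d$, the boundary $\partial S$ is the set of $v\in\mathbb{Z}^d\setminus S$ adjacent to some element of $S$. An alphabet $\mathcal{A}$ is a finite set with at least two elements. For $S\subset \mathbb{Z}^d$, an element of $\mathcal{A}^S$ is a configuration with shape $S$; for disjoint shapes, juxtaposition denotes concatenation; $w|_T$ denotes restriction to $T$. A $\mathbb{Z}^d$-measure is a Borel probability measure on $\mathcal{A}^{\mathbb{Z}^d}$ (product topology); for a configuration $w$ on a finite shape $S$, $\mu(w)$ denotes the measure of the cylinder set $\{x: x|_S=w\}$, and similarly for conditional measures. $\mu$ is stationary if it is invariant under all translations of $\mathbb{Z}^d$. A $\mathbb{Z}^d$-measure $\mu$ is a $\mathbb{Z}^d$ Markov random field (MRF) if for any finite $S\subset\mathbb{Z}^d$, any $\eta\in\mathcal{A}^S$, any finite $T$ with $\partial S\subseteq T\subseteq\mathbb{Z}^d\setminus S$, and any $\delta\in\mathcal{A}^T$ with $\mu(\delta)>0$, one has $\mu(\eta\mid\delta|_{\partial S})=\mu(\eta\mid\delta)$. Entropy: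 for finite $S$, $H_\mu(S)=\sum_{w\in\mathcal{A}^S}-\mu(w)\log\mu(w)$. For disjoint finite $S,T$, $H_\mu(S\mid T)=\sum_{w\in\mathcal{A}^{S\cup T},\,\mu(w|_T)>0}-\mu(w)\log\frac{\mu(w)}{\mu(w|_T)}$ (terms with $\mu(w)=0$ are omitted). The measure-theoretic entropy of a stationary $\mu$ is $h(\mu)=\lim_{j_1,\dots,j_d\to\infty}\frac{H_\mu(\prod_{i=1}^d[1,j_i])}{j_1j_2\cdots j_d}$ (the limit is known to exist). Lexicographic order on $\mathbb{Z}^d$: $x\prec y$ if for some $1\le k\le d$, $x_i=y_i$ for $i<k$ and $x_k<y_k$. $\mathbf{0}$ is the origin, $\mathcal{P}^+=\{z\in\mathbb{Z}^d: z\succeq\mathbf{0}\}$, $B_n=[-n,n]^d\cap\mathbb{Z}^d$ is the cube of side length $2n+1$ centered at $\mathbf{0}$, $S_n=B_n\cap\mathcal{P}^+$, and $U_n=B_n\cap\partial\mathcal{P}^+$. *)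

(* Defs.v *)
From HB Require Import structures.
From mathcomp Require Import all_boot all_order all_algebra finmap.
From mathcomp Require Import all_classical all_reals all_analysis.

Set Implicit Arguments.
Unset Strict Implicit.
Unset Printing Implicit Defensive.

Import Order.TTheory GRing.Theory Num.Theory.
Import numFieldNormedType.Exports.

Local Open Scope classical_set_scope.
Local Open Scope ring_scope.

(* The lattice Z^d is 'rV[int]_d.  Shapes are sets of sites; finite ones are
   turned into {fset _} by fset_set, which is only meaningful on finite sets:
   the finiteness of every shape used is proved below. *)

Section Lattice.
Variable d : nat.
Implicit Types (u v : 'rV[int]_d) (S : set 'rV[int]_d) (n : nat).

Definition adjacent u v : bool := \sum_(i < d) `|u ord0 i - v ord0 i| == 1.

Definition boundary S : set 'rV[int]_d :=
  [set v | ~ S v /\ exists2 u, S u & adjacent u v].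

Definition lex_lt u v : Prop :=
  exists2 k : 'I_d, (forall i : 'I_d, (i < k)%N -> u ord0 i = v ord0 i)
                  & u ord0 k < v ord0 k.

Definition Pplus : set 'rV[int]_d := [set z | z = 0 \/ lex_lt 0 z].

Definition cube n : set 'rV[int]_d :=
  [set v | forall i, - n%:Z <= v ord0 i <= n%:Z].

Definition Sn n : set 'rV[int]_d := cube n `&` Pplus.

Definition Un n : set 'rV[int]_d := cube n `&` boundary Pplus.

Definition box (j : 'I_d -> nat) : set 'rV[int]_d :=
  [set v | forall i, 1 <= v ord0 i <= (j i)%:Z].

Lemma finite_cube n : finite_set (cube n).
Proof.
pose f (g : {ffun 'I_d -> 'I_(n + n).+1}) : 'rV[int]_d :=
  \row_i ((g i)%:Z - n%:Z).
apply: (@sub_finite_set _ _ (f @` setT)); last exact: finite_image.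
move=> v vn; exists [ffun i => inord (absz (v ord0 i + n%:Z))] => //.
apply/rowP => i; rewrite mxE ffunE.
have /andP[vl vr] := vn i.
have v0 : 0 <= v ord0 i + n%:Z by rewrite -lerBlDr sub0r.
rewrite inordK; first by rewrite gez0_abs // addrK.
by rewrite ltnS -lez_nat gez0_abs // PoszD lerD2r.
Qed.

Lemma finite_Sn n : finite_set (Sn n).
Proof. exact/finite_setIl/finite_cube. Qed.

Lemma finite_Un n : finite_set (Un n).
Proof. exact/finite_setIl/finite_cube. Qed.

Lemma finite_box (j : 'I_d -> nat) : finite_set (box j).
Proof.
apply: (sub_finite_set _ (finite_cube (\max_i j i))) => v vj i.
have /andP[v1 vi] := vj i; apply/andP; split.
  by rewrite (le_trans _ (le_trans ler01 v1)) // oppr_le0.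
by rewrite (le_trans vi) // lez_nat leq_bigmax.
Qed.

Lemma finite_boundary S : finite_set S -> finite_set (boundary S).
Proof.
move=> fS; apply: (sub_finite_set _ (finite_image2 (fun u v => u + v) fS
  (finite_cube 1))) => v [_ [u Su /eqP uv]].
exists u => //; exists (v - u); last by rewrite addrC subrK.
move=> i; rewrite -ler_norml !mxE distrC.
suff: `|u ord0 i - v ord0 i| <= \sum_(k < d) `|u ord0 k - v ord0 k| by rewrite uv.
by rewrite (bigD1 i) //= lerDl sumr_ge0.
Qed.

End Lattice.

HB.mixin Record isAlphabet A & Finite A := {
  alphabet_gt1 : (1 < #|{: A}|)%N
}.

#[short(type="alphabetType")]
HB.structure Definition Alphabet := {A of Finite A & isAlphabet A}.

Lemma alphabet_inhab (A : alphabetType) : exists a : A, true.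
Proof.
by have /card_gt0P[a _] := ltnW (@alphabet_gt1 A); exists a.
Qed.

Definition config (d : nat) (A : alphabetType) : Type :=
  {ptws 'rV[int]_d -> discrete_topology A}.

HB.instance Definition _ d (A : alphabetType) := Topological.on (config d A).
(* A base point is required by measurableType; it plays no other role. *)
HB.instance Definition _ d (A : alphabetType) :=
  isPointed.Build (config d A) (fun=> xchoose (alphabet_inhab A)).

Definition borel_config (d : nat) (A : alphabetType) :=
  g_sigma_algebraType (@open (config d A)).

Section Measures.
Variables (R : realType) (d : nat) (A : alphabetType).
Local Notation site := 'rV[int]_d.
Implicit Types (S T : {fset site}) (mu : probability (borel_config d A) R).

Definition translate (v : site) (x : config d A) : config d A :=
  fun u => x (u + v).

Definition stationary mu : Prop :=
  forall (v : site) (E : set (borel_config d A)), measurable E ->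
    mu (translate v @^-1` E) = mu E.

Definition cylinder S (w : {ffun S -> A}) : set (borel_config d A) :=
  [set x | forall i : S, x (val i) = w i].

Definition restriction S T (sTS : (T `<=` S)%fset) (w : {ffun S -> A}) :
  {ffun T -> A} := [ffun i => w (fincl sTS i)].

Definition prob mu S (w : {ffun S -> A}) : R := fine (mu (cylinder w)).

(* For disjoint S and T, the intersection of the two cylinders is the cylinder
   of the concatenation of w and z. *)
Definition cond_prob mu S T (w : {ffun S -> A}) (z : {ffun T -> A}) : R :=
  fine (mu (cylinder w `&` cylinder z)) / prob mu z.

Definition markov_random_field mu : Prop :=
  forall S (eta : {ffun S -> A}) T
    (bT : (fset_set (boundary [set` S]) `<=` T)%fset) (delta : {ffun T -> A}),
    [disjoint S & T]%fset -> 0 < prob mu delta ->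
    cond_prob mu eta (restriction bT delta) = cond_prob mu eta delta.

Definition entropy mu S : R :=
  \sum_(w : {ffun S -> A}) - (prob mu w * ln (prob mu w)).

Definition cond_entropy mu S T : R :=
  \sum_(w : {ffun (S `|` T)%fset -> A} |
      (0 < prob mu (restriction (fsubsetUr S T) w)) && (prob mu w != 0))
    - (prob mu w * ln (prob mu w / prob mu (restriction (fsubsetUr S T) w))).

Definition all_to_infty : set_system ('I_d -> nat) :=
  filter_from setT (fun N : nat => [set j | forall i, (N <= j i)%N]).

Definition measure_entropy mu : R :=
  lim ((fun j => entropy mu (fset_set (box j)) / (\prod_(i < d) j i)%:R)
         @ all_to_infty).

End Measures.

(* Main.v *)
Require Import Defs.
From mathcomp Require Import all_boot all_order all_algebra finmap.
From mathcomp Require Import all_classical all_reals all_analysis.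
From mathcomp Require Import ring lra zify.

(* Let h be the infimum of H(0 | F) over the finite sets F of sites that precede
   0 in the lexicographic order.  By the chain rule along that order, the
   entropy of a box is a sum of terms H(v | F), with F made of sites before v;
   by stationarity each is at least h, and all but those of sites v close to a
   face of the box are at most h + e.  Hence h(mu) = h, and U_n is one of the
   sets F.  If F is any of them, then F and the boundary of S_n are disjoint
   from S_n, so the Markov property gives
   H(0 | boundary S_n) = H(0 | F, boundary S_n) <= H(0 | F). *)

Set Implicit Arguments.
Unset Strict Implicit.
Unset Printing Implicit Defensive.

Import Order.TTheory GRing.Theory Num.Theory.
Import numFieldNormedType.Exports.

Local Open Scope classical_set_scope.
Local Open Scope ring_scope.

(** * Submodularity of entropy for finite weighted sets *)

Section FiniteSubmodularity.
Variables (R : realType) (W B C D : finType) (p : W -> R).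
Variables (f : W -> B) (g : W -> C) (kf : B -> D) (kg : C -> D).
Hypothesis p_ge0 : forall w, 0 <= p w.
Hypothesis fg_inj : injective (fun w => (f w, g w)).
Hypothesis kfg : forall w, kf (f w) = kg (g w).

Let pf b := \sum_(w | f w == b) p w.
Let pg c := \sum_(w | g w == c) p w.
Let pk e := \sum_(w | kf (f w) == e) p w.

(** Gibbs' inequality: [p] is compared with the weight [G] that makes [f] and [g] conditionally
    independent given their common image in [D]. In entropy terms, H(f, g) + H(k) <= H(f) + H(g),
    with k the map to [D]. *)
Lemma submodular_ln :
  \sum_w p w * (ln (pf (f w)) + ln (pg (g w)) - ln (pk (kf (f w))) - ln (p w))
  <= 0.
Proof.
have pf0 b : 0 <= pf b by apply: sumr_ge0.
have pg0 c : 0 <= pg c by apply: sumr_ge0.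
have pk0 e : 0 <= pk e by apply: sumr_ge0.
pose G (y : B * C) := pf y.1 * pg y.2 / pk (kf y.1).
have G0 y : 0 <= G y by rewrite divr_ge0 ?mulr_ge0.
(* Where [p w] is positive, the term is [p w * ln t] with [t] the quotient of [G] by [p w], and
   [ln t <= t - 1]. *)
apply: (@le_trans _ _ (\sum_w (G (f w, g w) - p w))).
  apply: ler_sum => w _.
  have [pw0|pw0] := eqVneq (p w) 0.
    by rewrite pw0 mul0r subr0.
  have pw : 0 < p w by rewrite lt_def pw0 p_ge0.
  have le1 (P : pred W) : P w -> 0 < \sum_(v | P v) p v.
    move=> Pw; apply: lt_le_trans pw _.
    by rewrite (bigD1 w) //= lerDl sumr_ge0.
  have fw : 0 < pf (f w) by apply: le1.
  have gw : 0 < pg (g w) by apply: le1.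
  have kw : 0 < pk (kf (f w)) by apply: le1.
  rewrite -lnM ?posrE // -!ln_div ?posrE ?divr_gt0 ?mulr_gt0 //.
  set t := _ / p w.
  have t0 : 0 < t by rewrite !divr_gt0 ?mulr_gt0.
  have -> : G (f w, g w) - p w = p w * (t - 1).
    by rewrite mulrBr mulr1 /t mulrC divfK.
  rewrite ler_pM2l //.
  by rewrite -[t in ln t](subrKC 1); apply: le_ln1Dx; rewrite ltrBrDr addNr.
rewrite sumrB subr_le0.
have -> : \sum_w G (f w, g w) =
    \sum_(y in (fun w => (f w, g w)) @: [set: W]%SET) G y.
  rewrite big_imset /=; last by move=> ? ? _ _; apply: fg_inj.
  by apply: eq_bigl => w; rewrite finset.in_setT.
(* Since [G] is nonnegative, the sum may be extended from the image of [W] to all pairs that agree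
   in [D]. Summing over [c] then leaves at most [pf b]. *)
apply: (@le_trans _ _ (\sum_(y | kg y.2 == kf y.1) G y)).
  rewrite big_mkcond [leRHS]big_mkcond; apply: ler_sum => y _ /=.
  case: imsetP => [[w _ ->]/=|_]; first by rewrite kfg eqxx.
  by case: ifP.
rewrite -(pair_big_dep xpredT (fun b c => kg c == kf b)
  (fun b c => G (b, c))) /=.
have -> : \sum_w p w = \sum_b pf b by exact: partition_big.
apply: ler_sum => b _.
rewrite /G /= -mulr_suml -mulr_sumr.
have -> : \sum_(c | kg c == kf b) pg c = pk (kf b).
  rewrite /pk (partition_big g (fun c => kg c == kf b)) /=; last first.
    by move=> w; rewrite kfg.
  apply: eq_bigr => c /eqP kc; apply: eq_bigl => w.
  by case: eqVneq => [gw|]; rewrite ?andbT ?andbF // kfg gw kc eqxx.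
(* The inverse of 0 is 0, so in this case the term vanishes and stays below [pf b]. *)
have [k0|k0] := eqVneq (pk (kf b)) 0; first by rewrite k0 invr0 mulr0.
by rewrite mulfK.
Qed.

End FiniteSubmodularity.

(** * Patterns, restrictions and cylinders *)

Section Shapes.
Variables (d : nat) (A : alphabetType).
Local Notation site := 'rV[int]_d.
Implicit Types S T K : {fset site}.

Definition pattern S (x : site -> A) : {ffun S -> A} := [ffun i => x (val i)].

(** A total function can be read at translated sites without membership proofs; the letter used
    outside [S] is arbitrary. *)
Definition extension S (w : {ffun S -> A}) : site -> A :=
  fun u => if insub u is Some i then w i else xchoose (alphabet_inhab A).

Lemma extensionK S : cancel (@extension S) (pattern S).
Proof. by move=> w; apply/ffunP => i; rewrite ffunE /extension valK. Qed.

Lemma extensionE S (w : {ffun S -> A}) u (uS : u \in S) :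
  extension w u = w [` uS]%fset.
Proof. by rewrite /extension insubT. Qed.

Lemma extension_pattern S (x : site -> A) u :
  u \in S -> extension (pattern S x) u = x u.
Proof. by move=> uS; rewrite extensionE ffunE. Qed.

Lemma restriction_pattern S T (sTS : (T `<=` S)%fset) (x : site -> A) :
  restriction sTS (pattern S x) = pattern T x.
Proof. by apply/ffunP => i; rewrite !ffunE. Qed.

Lemma restriction_trans S T K (TS : (T `<=` S)%fset) (KT : (K `<=` T)%fset)
    (KS : (K `<=` S)%fset) (w : {ffun S -> A}) :
  restriction KT (restriction TS w) = restriction KS w.
Proof. by apply/ffunP => i; rewrite !ffunE; congr (w _); apply: val_inj. Qed.

Lemma cylinderE S (w : {ffun S -> A}) : cylinder w = [set x | pattern S x = w].
Proof.
apply/seteqP; split => x /= h; first by apply/ffunP => i; rewrite ffunE h.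
by move=> i; rewrite -h ffunE.
Qed.

(** A cylinder is a finite intersection of preimages of open singletons under the continuous
    coordinate maps. *)
Lemma measurable_cylinder S (w : {ffun S -> A}) : measurable (cylinder w).
Proof.
have -> : cylinder w = \bigcap_(i in [set: S]) [set x | x (val i) = w i].
  by apply/seteqP; split => x /= h => [i _|i]; apply: h.
apply: fin_bigcap_measurable => // i _; apply: sub_sigma_algebra.
have cp : continuous (fun x : config d A => x (val i) : discrete_topology A).
  exact: (@proj_continuous _ (fun=> discrete_topology A)).
apply: (iffLR (continuousP _) cp [set w i]); exact: discrete_open.
Qed.

End Shapes.
Arguments pattern {d A}.

(** * Marginals and entropies of finite shapes *)

Section Marginals.
Variables (R : realType) (d : nat) (A : alphabetType).
Variable mu : probability (borel_config d A) R.
Local Notation site := 'rV[int]_d.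
Implicit Types S T : {fset site}.

(** The cylinders of the patterns extending [z] partition the cylinder of [z]. Taking [E] to be the
    whole space gives marginals; taking a cylinder gives the sums needed for the Markov property. *)
Lemma prob_setI_sum S T (sTS : (T `<=` S)%fset) (z : {ffun T -> A}) E :
  measurable E ->
  fine (mu (cylinder z `&` E)) =
  \sum_(w | restriction sTS w == z) fine (mu (cylinder w `&` E)).
Proof.
move=> mE.
have mcE (U : {fset site}) (w : {ffun U -> A}) : measurable (cylinder w `&` E).
  by apply: measurableI => //; apply: measurable_cylinder.
rewrite sum_fine; last by move=> w _; apply: fin_num_measure.
congr fine; rewrite -big_enum fsbig_seq ?enum_uniq //.
rewrite -measure_fin_bigcup //; last first.
  move=> w w' _ _ [x []].
  by rewrite !cylinderE => -[/= <- _] [/= <- _].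
congr (mu _); rewrite !cylinderE; apply/seteqP; split => x.
  move=> [xz Ex]; exists (pattern S x); rewrite ?cylinderE //.
  by rewrite /mkset mem_enum -topredE; apply/eqP; rewrite restriction_pattern xz.
move=> [w]; rewrite /mkset mem_enum cylinderE => rwz [xw Ex]; split=> //.
have /eqP <- : restriction sTS w == z := rwz.
by rewrite -xw restriction_pattern.
Qed.

Lemma prob_restriction S T (sTS : (T `<=` S)%fset) (z : {ffun T -> A}) :
  prob mu z = \sum_(w | restriction sTS w == z) prob mu w.
Proof.
have := prob_setI_sum sTS z measurableT; rewrite setIT => h.
by rewrite /prob h; apply: eq_bigr => w _; rewrite setIT.
Qed.

Lemma prob_ge0 S (w : {ffun S -> A}) : 0 <= prob mu w.
Proof. exact: fine_ge0. Qed.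

Lemma prob_restriction_ge S T (sTS : (T `<=` S)%fset) (w : {ffun S -> A}) :
  prob mu w <= prob mu (restriction sTS w).
Proof.
rewrite (prob_restriction sTS) (bigD1 w) //= lerDl.
by apply: sumr_ge0 => v _; exact: prob_ge0.
Qed.

(** Writing entropies of several shapes as sums over patterns on one larger shape lets them be
    compared term by term. *)
Lemma entropy_ext S T (sTS : (T `<=` S)%fset) :
  entropy mu T =
  - \sum_(w : {ffun S -> A}) prob mu w * ln (prob mu (restriction sTS w)).
Proof.
rewrite /entropy sumrN; congr (- _).
rewrite [RHS](partition_big (restriction sTS) xpredT) //=.
apply: eq_bigr => z _; rewrite [X in X * _ = _](prob_restriction sTS) mulr_suml.
by apply: eq_bigr => w /eqP ->.
Qed.

(** Patterns of probability zero contribute nothing on either side; for the others the restriction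
    also has positive probability, so the logarithm of the quotient splits. *)
Lemma cond_entropyE S T :
  cond_entropy mu S T = entropy mu (S `|` T)%fset - entropy mu T.
Proof.
rewrite (entropy_ext (fsubsetUr S T)) /entropy /cond_entropy opprK -big_split /=.
rewrite big_mkcond; apply: eq_bigr => w _.
have le := prob_restriction_ge (fsubsetUr S T) w.
have [->|p0] := eqVneq (prob mu w) 0; first by rewrite andbF !mul0r oppr0 addr0.
have pw : 0 < prob mu w by rewrite lt_def p0 prob_ge0.
have pr := lt_le_trans pw le.
by rewrite pr /= ln_div // mulrBr opprB addrC.
Qed.

Lemma cond_entropy_ge0 S T : 0 <= cond_entropy mu S T.
Proof.
apply: sumr_ge0 => w /andP[p0 p1]; rewrite oppr_ge0.
rewrite mulr_ge0_le0 ?prob_ge0 // ln_le0 // ler_pdivrMr // mul1r.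
exact: prob_restriction_ge.
Qed.

(** This is [submodular_ln] for the law of patterns on the union, with the restrictions to [S] and
    [T] as [f] and [g]; together these determine the pattern. *)
Lemma entropy_submodular S T K : (K `<=` S)%fset -> (K `<=` T)%fset ->
  entropy mu (S `|` T)%fset + entropy mu K <= entropy mu S + entropy mu T.
Proof.
move=> KS KT.
have SU := fsubsetUl S T; have TU := fsubsetUr S T.
have KU := fsubset_trans KS SU.
have := @submodular_ln R _ _ _ _ (@prob R d A mu (S `|` T)%fset)
  (restriction SU) (restriction TU) (restriction KS) (restriction KT).
move=> /(_ (@prob_ge0 _)).
have inj : injective (fun w : {ffun (S `|` T)%fset -> A} =>
    (restriction SU w, restriction TU w)).
  move=> w w' [/ffunP eS /ffunP eT]; apply/ffunP => -[u uU].
  have /fsetUP[uS|uT] := uU.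
    have := eS [` uS]%fset; rewrite !ffunE.
    by congr (w _ = w' _); apply: val_inj.
  have := eT [` uT]%fset; rewrite !ffunE.
  by congr (w _ = w' _); apply: val_inj.
move=> /(_ inj).
have kk (w : {ffun _ -> A}) :
    restriction KS (restriction SU w) = restriction KU w.
  exact: restriction_trans.
have kk' (w : {ffun _ -> A}) :
    restriction KT (restriction TU w) = restriction KU w.
  exact: restriction_trans.
move=> /(_ (fun w => etrans (kk w) (esym (kk' w)))) H.
rewrite (entropy_ext SU) (entropy_ext TU) (entropy_ext KU).
rewrite /entropy sumrN.
set a := \sum_w _; set b := \sum_w _; set c := \sum_w _; set e := \sum_w _.
suff : c + e - b - a <= 0 by lra.
apply: le_trans H; rewrite le_eqVlt; apply/orP; left; apply/eqP.
rewrite -big_split -!sumrB; apply: eq_bigr => w _ /=.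
rewrite -!prob_restriction kk.
have -> : \sum_(v | restriction KS (restriction SU v) == restriction KU w)
     prob mu v = prob mu (restriction KU w).
  by rewrite (prob_restriction KU); apply: eq_bigl => v; rewrite kk.
ring.
Qed.

Lemma cond_entropy_mono S T T' : (T `<=` T')%fset ->
  cond_entropy mu S T' <= cond_entropy mu S T.
Proof.
move=> TT'; rewrite !cond_entropyE.
(* The two shapes are the union of [S] and [T], and [T']; both contain [T]. *)
have := entropy_submodular (fsubsetUr S T) TT'.
rewrite -fsetUA (fsetUidPr _ _ TT'); lra.
Qed.

Lemma entropy0 : entropy mu fset0 = 0.
Proof.
rewrite /entropy big1 // => w _.
have -> : prob mu w = 1; last by rewrite ln1 mulr0 oppr0.
rewrite /prob cylinderE (_ : [set _ | _] = setT) ?probability_setT //.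
by apply/seteqP; split => // x _ /=; apply/ffunP => -[].
Qed.

End Marginals.

(** * The Markov property in terms of conditional entropy *)

Section MarkovEntropy.
Variables (R : realType) (d : nat) (A : alphabetType).
Variable mu : probability (borel_config d A) R.
Local Notation site := 'rV[int]_d.
Implicit Types S T K : {fset site}.

Lemma cylinder_fsetU S T (w : {ffun (S `|` T)%fset -> A}) :
  cylinder w = cylinder (restriction (fsubsetUl S T) w)
    `&` cylinder (restriction (fsubsetUr S T) w).
Proof.
apply/seteqP; split => [x xw|x [xS xT] [u uU]]; first by
  split=> i; rewrite ffunE -xw.
have /fsetUP[uS|uT] := uU.
  have := xS [` uS]%fset; rewrite ffunE => /= ->.
  by congr (w _); apply: val_inj.
have := xT [` uT]%fset; rewrite ffunE => /= ->.
by congr (w _); apply: val_inj.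
Qed.

(* The Markov property is stated for full configurations on [S]; summing over
   those that extend a given configuration on [K] transfers it to [K]. *)
Lemma markov_cond_entropy S T K : markov_random_field mu ->
  (fset_set (boundary [set` S]) `<=` T)%fset -> [disjoint S & T]%fset ->
  (K `<=` S)%fset ->
  cond_entropy mu K T = cond_entropy mu K (fset_set (boundary [set` S])).
Proof.
set D := fset_set _ => mrf DT ST KS.
have cyl_sum (U : {fset site}) (w : {ffun (K `|` U)%fset -> A}) :
    prob mu w = \sum_(eta : {ffun S -> A} |
        restriction KS eta == restriction (fsubsetUl K U) w)
      fine (mu (cylinder eta `&` cylinder (restriction (fsubsetUr K U) w))).
  rewrite -prob_setI_sum; last exact: measurable_cylinder.
  by rewrite /prob cylinder_fsetU.
have KDT : (K `|` D `<=` K `|` T)%fset by rewrite fsetUS.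
have DU : (D `<=` K `|` T)%fset by rewrite fsubsetU // DT orbT.
(* All four entropies become sums over patterns on the union of [K] and [T], so it suffices to match
   conditional probabilities given [T] and given [D]. *)
rewrite !cond_entropyE (entropy_ext mu (fsubsetUr K T)) (entropy_ext mu KDT).
rewrite (entropy_ext mu DU) /entropy sumrN !opprK -!(addrC (\sum_w _)) -!sumrB.
apply: eq_bigr => w _; rewrite -!mulrBr.
have [->|pw0] := eqVneq (prob mu w) 0; first by rewrite !mul0r.
have pw : 0 < prob mu w by rewrite lt_def pw0 prob_ge0.
have rpos (U : {fset site}) (sU : (U `<=` K `|` T)%fset) :
    0 < prob mu (restriction sU w).
  exact: lt_le_trans pw (prob_restriction_ge mu sU w).
congr (_ * _); apply: oppr_inj; rewrite !opprB -!ln_div ?posrE //; congr ln.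
rewrite (cyl_sum _ w) (cyl_sum _ (restriction KDT w)) !mulr_suml.
rewrite (restriction_trans _ _ (fsubsetUl K T)) (restriction_trans _ _ DU).
apply: eq_bigr => eta _.
have := mrf S eta T DT (restriction (fsubsetUr K T) w) ST (rpos _ _).
by rewrite (restriction_trans _ _ DU).
Qed.

End MarkovEntropy.

(** * Translation invariance of entropy *)

Section Translation.
Variables (R : realType) (d : nat) (A : alphabetType).
Variable mu : probability (borel_config d A) R.
Local Notation site := 'rV[int]_d.
Implicit Types S T : {fset site}.

Definition shift_fset (v : site) S : {fset site} := [fset (u + v)%R | u in S]%fset.

Lemma mem_shift_fset v S (u : site) : (u \in shift_fset v S) = (u - v \in S).
Proof.
apply/imfsetP/idP => /= [[x xS ->]|uS]; first by rewrite addrK.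
by exists (u - v); rewrite ?subrK.
Qed.

Hypothesis mu_stat : stationary mu.

(** Translation is a bijection [h] between the patterns on the two shapes, and the preimage of the
    cylinder of [h w] under [translate v] is the cylinder of [w]. *)
Lemma entropy_shift v S : entropy mu (shift_fset v S) = entropy mu S.
Proof.
pose h (w : {ffun shift_fset v S -> A}) : {ffun S -> A} :=
  pattern S (fun u => extension w (u + v)).
pose h' (w : {ffun S -> A}) : {ffun shift_fset v S -> A} :=
  pattern (shift_fset v S) (fun u => extension w (u - v)).
have hK : cancel h h'.
  move=> w; rewrite -[RHS]extensionK; apply/ffunP => -[u /= uS].
  rewrite !ffunE /=; rewrite extension_pattern ?subrK //.
  by rewrite -mem_shift_fset.
have h'K : cancel h' h.
  move=> w; rewrite -[RHS]extensionK; apply/ffunP => -[u /= uS].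
  rewrite !ffunE /=; rewrite extension_pattern ?addrK //.
  by rewrite mem_shift_fset addrK.
rewrite /entropy [RHS](reindex h); last by exists h' => w _.
apply: eq_bigr => w _.
suff -> : prob mu (h w) = prob mu w by [].
rewrite /prob -(mu_stat v); last exact: measurable_cylinder.
congr (fine (mu _)); rewrite !cylinderE; apply/seteqP; split => x /= xw.
  rewrite -[RHS]hK -xw; apply/ffunP => -[u /= uS].
  rewrite !ffunE /= extension_pattern -?mem_shift_fset //.
  by rewrite /translate subrK.
rewrite -xw; apply/ffunP => -[u /= uS].
by rewrite !ffunE /= extension_pattern // mem_shift_fset addrK.
Qed.

Lemma cond_entropy_shift v S T :
  cond_entropy mu (shift_fset v S) (shift_fset v T) = cond_entropy mu S T.
Proof.
rewrite !cond_entropyE entropy_shift -(entropy_shift v (S `|` T)%fset).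
congr (entropy mu _ - _); apply/fsetP => u.
by rewrite in_fsetU !mem_shift_fset in_fsetU.
Qed.

End Translation.

(** * The lexicographic order through its positive cone *)

Section LexicographicOrder.
Variable d : nat.
Local Notation site := 'rV[int]_d.
Implicit Types (u v : site) (S : {fset site}).

Lemma Pplus0 : Pplus (0 : site). Proof. by left. Qed.

Lemma lex_lt0P u : lex_lt 0 u <->
  exists2 k : 'I_d, (forall i : 'I_d, (i < k)%N -> u ord0 i = 0) & 0 < u ord0 k.
Proof.
have z i : (0 : site) ord0 i = 0 by rewrite mxE.
by split=> -[k k0 kp]; exists k; rewrite ?z // in kp * => i /k0; rewrite z.
Qed.

(** For nonzero summands, the first nonzero coordinate of the sum sits at the smaller of the two
    leading indices and is positive there. *)
Lemma PplusD u v : Pplus u -> Pplus v -> Pplus (u + v).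
Proof.
case=> [->|/lex_lt0P[k k0 kp]]; first by rewrite add0r.
case=> [->|/lex_lt0P[l l0 lp]].
  by rewrite addr0; right; apply/lex_lt0P; exists k.
right; apply/lex_lt0P; have [kl|lk|kl] := ltngtP k l.
- exists k => [i ik|]; rewrite mxE.
    by rewrite k0 // l0 ?addr0 // (ltn_trans ik).
  by rewrite (l0 k) // addr0.
- exists l => [i il|]; rewrite mxE.
    by rewrite k0 ?l0 ?addr0 // (ltn_trans il).
  by rewrite (k0 l) // add0r.
- have kl' : k = l by apply: val_inj.
  subst l; exists k => [i ik|]; rewrite mxE; first by rewrite k0 // l0 // addr0.
  exact: addr_gt0.
Qed.

Lemma Pplus_anti u : Pplus u -> Pplus (- u) -> u = 0.
Proof.
case=> // /lex_lt0P[k k0 kp]; case=> [/eqP|/lex_lt0P[l l0]].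
  by rewrite oppr_eq0 => /eqP.
rewrite mxE oppr_gt0 => lp; exfalso; have [kl|lk|kl] := ltngtP k l.
- by have /eqP := l0 k kl; rewrite mxE oppr_eq0 gt_eqF.
- by have := lp; rewrite k0 // ltxx.
- by have := lt_trans lp kp; rewrite (val_inj kl) ltxx.
Qed.

Lemma Pplus_total u : Pplus u \/ Pplus (- u).
Proof.
have [->|u0] := eqVneq u 0; first by left; left.
have /existsP[i0 ui0] : [exists i, u ord0 i != 0].
  apply: contraNT u0; rewrite negb_exists => /forallP u0.
  by apply/eqP/rowP => i; rewrite mxE; apply/eqP; rewrite -[_ == _]negbK.
(* The index [k] of the first nonzero coordinate decides the sign. *)
case: (@arg_minnP _ i0 (fun i => u ord0 i != 0) val ui0) => k uk kmin.
have kz (i : 'I_d) : (i < k)%N -> u ord0 i = 0.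
  by move=> ik; apply: contraTeq ik => /kmin; rewrite leqNgt.
have [up|un|/eqP] := ltgtP 0 (u ord0 k); last by rewrite eq_sym (negPf uk).
- by left; right; apply/lex_lt0P; exists k.
- right; right; apply/lex_lt0P; exists k => [i /kz|]; rewrite !mxE ?oppr_gt0 //.
  by move=> ->; rewrite oppr0.
Qed.

(** Strict precedence is expressed through [u - v], so that translating by [- v] lands directly
    outside [Pplus]. *)
Definition lex_before S v : {fset site} :=
  [fset u in S | ~~ `[< Pplus (u - v)%R >]]%fset.

Lemma lex_max S : S != fset0 ->
  exists2 v, v \in S & forall u, u \in S -> Pplus (v - u).
Proof.
have H (s : seq site) : s != [::] ->
    exists2 v, v \in s & forall u, u \in s -> Pplus (v - u).
  elim: s => // a s IH _; have [->|s0] := eqVneq s [::].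
    exists a; rewrite ?inE // => u.
    by rewrite inE => /eqP ->; rewrite subrr; left.
  have [v vs vmax] := IH s0.
  have [av|va] := Pplus_total (a - v).
    exists a; first by rewrite inE eqxx.
    move=> u; rewrite inE => /orP[/eqP ->|/vmax vu].
      by rewrite subrr; left.
    by rewrite -(subrKA v); apply: PplusD.
  exists v; first by rewrite inE vs orbT.
  move=> u; rewrite inE => /orP[/eqP ->|/vmax //].
  by rewrite -opprB.
by move=> S0; apply: H; rewrite -size_eq0 cardfs_eq0.
Qed.

End LexicographicOrder.

(** * The chain rule along the lexicographic order *)

Section ChainRule.
Variables (R : realType) (d : nat) (A : alphabetType).
Variable mu : probability (borel_config d A) R.
Local Notation site := 'rV[int]_d.
Implicit Types S : {fset site}.

(** Induction on the cardinal, removing the last site [v]: everything else in [S] precedes it, so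
    its term is the entropy lost by the removal. *)
Lemma entropy_chain S :
  entropy mu S = \sum_(v <- S) cond_entropy mu [fset v]%fset (lex_before S v).
Proof.
have [n] := ubnP #|` S|; elim: n S => // n IH S Sn.
have [->|S0] := eqVneq S fset0; first by rewrite entropy0 big_seq_fset0.
have [v vS vmax] := lex_max S0.
have nP u : u \in (S `\ v)%fset -> ~ Pplus (u - v).
  rewrite in_fsetD1 => /andP[uv /vmax vu] uv'.
  move/eqP: uv; apply; apply/eqP; rewrite -subr_eq0; apply/eqP.
  by apply: Pplus_anti => //; rewrite opprB.
rewrite (big_fsetD1 v) //=.
have -> : lex_before S v = (S `\ v)%fset.
  apply/fsetP => u; rewrite !inE /=; apply/andP/andP => -[].
    move=> uS /asboolPn uP; split=> //; apply/eqP => uv; apply: uP.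
    by rewrite uv subrr; left.
  by move=> uv uS; split=> //; apply/asboolPn/nP; rewrite !inE uv.
rewrite cond_entropyE fsetD1K // -[LHS](subrK (entropy mu (S `\ v)%fset)).
congr (_ + _); rewrite IH; last first.
  by move: Sn; rewrite (cardfsD1 v S) vS.
(* Removing [v] does not change the predecessors of any other site, because [v] comes last. *)
apply: eq_big_seq => u uS; congr cond_entropy; apply/fsetP => x; rewrite !inE /=.
case: (eqVneq x v) => //= ->; apply/esym/negbTE; rewrite negb_and negbK.
apply/orP; right; apply/asboolP/vmax.
by move: uS; rewrite in_fsetD1 => /andP[].
Qed.

End ChainRule.

(** * A product inequality, and counting sites in boxes *)

Lemma ler_prodB1 (R : realDomainType) (I : Type) (s : seq I) (x : I -> R) :
  (forall i, 0 <= x i <= 1) ->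
  1 - \sum_(i <- s) x i <= \prod_(i <- s) (1 - x i).
Proof.
move=> x01.
(* The induction also carries the upper bound 1 on the product, which controls the cross term. *)
suff /andP[] : 1 - \sum_(i <- s) x i <= \prod_(i <- s) (1 - x i) <= 1 by [].
elim: s => [|i s /andP[IH P1]]; first by rewrite !big_nil subr0 lexx.
have /andP[x0 x1] := x01 i.
have P0 : 0 <= \prod_(k <- s) (1 - x k).
  by apply: prodr_ge0 => k _; have /andP[_] := x01 k; rewrite subr_ge0.
rewrite !big_cons mulrBl mul1r; apply/andP; split; last by nra.
rewrite opprD addrCA addrC; apply: lerD => //; rewrite lerN2.
by rewrite -[leRHS]mulr1 ler_wpM2l.
Qed.

Section Boxes.
Variable d : nat.
Local Notation site := 'rV[int]_d.
Implicit Types (j : 'I_d -> nat).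

Definition box_fset j : {fset site} := fset_set (box j).

Lemma mem_box_fset j (v : site) :
  (v \in box_fset j) = [forall i, 1 <= v ord0 i <= (j i)%:Z].
Proof.
rewrite in_fset_set; last exact: finite_box.
by apply/idP/forallP => [/set_mem //|h]; apply/mem_set.
Qed.

Lemma card_box_fset j : #|` box_fset j| = (\prod_i j i)%N.
Proof.
(* Ordinals start at 0 and box coordinates at 1, hence the successor. *)
pose f (g : {dffun forall i : 'I_d, 'I_(j i)}) : site := \row_i (g i).+1%:Z.
have f_inj : injective f.
  move=> g g' /rowP e; apply/ffunP => i; apply: val_inj.
  by have := e i; rewrite !mxE => -[].
have -> : box_fset j = [fset f g | g in {dffun forall i : 'I_d, 'I_(j i)}]%fset.
  apply/fsetP => v; rewrite mem_box_fset; apply/forallP/imfsetP => /=.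
    move=> vj; have vb i : (absz (v ord0 i - 1) < j i)%N.
      have /andP[v1 v2] := vj i.
      by rewrite -ltz_nat gez0_abs ?subr_ge0 // ltrBlDr ltzD1.
    exists [ffun i => Ordinal (vb i)] => //.
    apply/rowP => i; rewrite mxE ffunE /=; have /andP[v1 v2] := vj i.
    by rewrite -[in RHS]addn1 PoszD gez0_abs ?subr_ge0 // subrK.
  move=> [g _ ->] i; rewrite mxE; apply/andP; split; last by rewrite lez_nat.
  by rewrite lez_nat.
rewrite card_imfset //= -cardE card_dep_ffun.
rewrite foldrE big_map big_enum /=; apply: eq_bigr => i _; exact: card_ord.
Qed.

Lemma finite_fset_cube (F : {fset site}) :
  exists m : nat, forall u, u \in F -> cube m u.
Proof.
exists (\max_(u : F) \max_i absz (val u ord0 i))%N => u uF i.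
rewrite -ler_norml -abszE lez_nat.
apply: leq_trans (leq_bigmax [` uF]%fset) => /=.
exact: (leq_bigmax (F := fun k => absz (u ord0 k))).
Qed.

Lemma all_to_infty_proper : ProperFilter (@all_to_infty d).
Proof.
apply: filter_from_proper => [|N _]; last by exists (fun=> N) => i /=.
apply: filter_from_filter; first by exists 0%N.
move=> M N _ _; exists (maxn M N) => // j h.
by split=> i; apply: leq_trans (h i); rewrite ?leq_maxl ?leq_maxr.
Qed.

End Boxes.

(** * Entropy as an infimum over finite pasts *)

Section EntropyAsInfimum.
Variables (R : realType) (d : nat) (A : alphabetType).
Variable mu : probability (borel_config d A) R.
Hypothesis mu_stat : stationary mu.
Local Notation site := 'rV[int]_d.
Implicit Types (F S : {fset site}) (j : 'I_d -> nat).

Let H0 F : R := cond_entropy mu [fset 0]%fset F.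

Definition past_entropies : set R :=
  [set H0 F | F in [set F : {fset site} | forall u : site, u \in F -> ~ Pplus u]].

Lemma past_entropies_lbound : has_lbound past_entropies.
Proof. by exists 0 => _ [F _ <-]; exact: cond_entropy_ge0. Qed.

Lemma past_entropies_has_inf : has_inf past_entropies.
Proof.
by split; [exists (H0 fset0), fset0 | exact: past_entropies_lbound].
Qed.

Lemma shift_fset1 (v : site) : shift_fset v [fset 0]%fset = [fset v]%fset.
Proof. by apply/fsetP => u; rewrite mem_shift_fset !inE subr_eq0. Qed.

(** Translation by [- v] carries [v] to the origin and its predecessors to a finite past of the
    origin. *)
Lemma cond_entropy_before_ge S v :
  inf past_entropies <= cond_entropy mu [fset v]%fset (lex_before S v).
Proof.
rewrite -(cond_entropy_shift mu_stat (- v)); apply: ge_inf.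
  exact: past_entropies_lbound.
exists (shift_fset (- v) (lex_before S v)); last first.
  rewrite /H0; suff <- : shift_fset (- v) [fset v]%fset = [fset 0]%fset by [].
  by apply/fsetP => u; rewrite mem_shift_fset !inE opprK -subr_eq0 addrK.
by move=> u /=; rewrite mem_shift_fset !inE /= opprK addrK => /andP[_ /asboolPn].
Qed.

Lemma cond_entropy_before_le S v F : (shift_fset v F `<=` lex_before S v)%fset ->
  cond_entropy mu [fset v]%fset (lex_before S v) <= H0 F.
Proof.
move=> FS; apply: le_trans (cond_entropy_mono mu _ FS) _.
by rewrite -shift_fset1 cond_entropy_shift.
Qed.

Lemma entropy_box_ge j :
  (\prod_i j i)%:R * inf past_entropies <= entropy mu (box_fset j).
Proof.
rewrite entropy_chain -card_box_fset card_fset_sum1 natr_sum mulr_suml.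
by apply: ler_sum => v _; rewrite mul1r cond_entropy_before_ge.
Qed.

(* Away from the faces of the box, at distance at least [m], the part of the
   box before [v] contains the translate of [F] by [v]. *)
Lemma entropy_box_le j F m : (forall u : site, u \in F -> ~ Pplus u) ->
  (forall u : site, u \in F -> cube m u) -> (forall i, m.*2 <= j i)%N ->
  entropy mu (box_fset j) <= (\prod_i j i)%:R * H0 F +
    ((\prod_i j i)%:R - (\prod_i (j i - m.*2))%:R) * H0 fset0.
Proof.
move=> Fpast Fm mj.
(* [G] is the interior of the box: [m] layers are removed at each of the two faces in every
   direction. *)
pose G := shift_fset (const_mx m%:Z) (box_fset (fun i => j i - m.*2)%N).
have GE v : v \in G -> forall i, m%:Z + 1 <= v ord0 i <= (j i)%:Z - m%:Z.
  rewrite mem_shift_fset mem_box_fset => /forallP + i => /(_ i).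
  rewrite !mxE; move: (v ord0 i) (j i) (mj i) => x k mk /andP[? ?].
  by apply/andP; split; lia.
have Gbox : (G `<=` box_fset j)%fset.
  apply/fsubsetP => v /GE vG; rewrite mem_box_fset; apply/forallP => i.
  by move: (v ord0 i) (j i) (vG i) => x k /andP[? ?]; apply/andP; split; lia.
have cardG : #|` G| = (\prod_i (j i - m.*2))%N.
  by rewrite card_imfset /= ?card_box_fset // => u v; apply: addIr.
have H00 : 0 <= H0 fset0 by exact: cond_entropy_ge0.
have HF0 : 0 <= H0 F by exact: cond_entropy_ge0.
rewrite -card_box_fset -cardG -natrB ?fsubset_leq_card // -cardfsDS //.
rewrite entropy_chain.
(* Sites outside [G] are only bounded by the unconditioned entropy [H0 fset0]; adding the
   nonnegative [H0 F] there as well keeps the main term uniform. *)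
apply: (@le_trans _ _ (\sum_(v <- box_fset j)
    (H0 F + if v \in G then 0 else H0 fset0))).
  rewrite big_seq [leRHS]big_seq; apply: ler_sum => v vj.
  case: ifP => [vG|_].
    rewrite addr0; apply: cond_entropy_before_le; apply/fsubsetP => u.
    rewrite mem_shift_fset !inE /= => uF.
    apply/andP; split; last by apply/asboolPn/Fpast.
    rewrite mem_box_fset; apply/forallP => i.
    have := GE v vG i; have := Fm _ uF i; rewrite !mxE.
    by move: (u ord0 i) (v ord0 i) (j i) => x y k /andP[? ?] /andP[? ?];
      apply/andP; split; lia.
  rewrite -[leLHS]add0r lerD // cond_entropy_before_le //.
  by apply/fsubsetP => u; rewrite mem_shift_fset inE.
rewrite big_split /= !card_fset_sum1 !natr_sum !mulr_suml.
apply: lerD; first by apply: ler_sum => v _; rewrite mul1r.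
rewrite -(big_fset_incl _ (fsubsetDl _ G)) /=; last first.
  by move=> v vj; rewrite in_fsetD vj andbT negbK => ->.
rewrite big_seq [leRHS]big_seq; apply: ler_sum => v.
by rewrite in_fsetD mul1r => /andP[/negPf -> _].
Qed.

Lemma measure_entropy_inf : measure_entropy mu = inf past_entropies.
Proof.
rewrite /measure_entropy; apply: cvg_lim; first exact: norm_hausdorff.
  exact: all_to_infty_proper.
have FF := @all_to_infty_proper d.
apply/cvgrPdist_le => e e0.
set h := inf _.
have e20 : 0 < e / 2 by rewrite divr_gt0.
(* One half of [e] pays for replacing the infimum by [H0 F], the other half for the sites near the
   faces. *)
have [_ [F Fpast <-] hF] := inf_adherent e20 past_entropies_has_inf.
have [m Fm] := finite_fset_cube F.
have H00 : 0 <= H0 fset0 by exact: cond_entropy_ge0.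
(* When all sides are at least [N], the sites near the faces cost at most [K / N] per site of the
   box; [N] is chosen to make this at most [e / 2]. *)
pose K : R := m.*2%:R * d%:R * H0 fset0.
have K0 : 0 <= K by rewrite !mulr_ge0.
pose N := (maxn m.*2 (Num.bound (K / (e / 2)))).+1.
have KN : K <= e / 2 * N%:R.
  rewrite mulrC -ler_pdivrMr //; apply: ltW.
  apply: lt_le_trans (archi_boundP (divr_ge0 K0 (ltW e20))) _.
  by rewrite ler_nat /N ltnW // ltnS leq_maxr.
exists N => // j Nj /=.
have mj i : (m.*2 <= j i)%N.
  by apply: leq_trans (Nj i); rewrite /N ltnW // ltnS leq_maxl.
have j0 i : (0 < j i)%N by exact: leq_trans (Nj i).
set V : R := (\prod_i j i)%:R.
have V0 : 0 < V by rewrite ltr0n prodn_gt0.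
have lo := entropy_box_ge j; have up := entropy_box_le Fpast Fm mj.
rewrite -/V -/h in lo up.
(* The interior fraction is the product of the factors [1 - 2m / j i], bounded below by
   [ler_prodB1]. *)
have ratio : (\prod_i (j i - m.*2))%:R >= V * (1 - m.*2%:R * d%:R / N%:R).
  rewrite /V !natr_prod.
  have -> : \prod_i (j i - m.*2)%:R =
      \prod_i (j i)%:R * \prod_i (1 - m.*2%:R / (j i)%:R) :> R.
    rewrite -big_split; apply: eq_bigr => i _ /=.
    by rewrite natrB // mulrBr mulr1 mulrCA divff ?mulr1 // pnatr_eq0 -lt0n.
  rewrite ler_pM2l -?natr_prod //.
  apply: le_trans (ler_prodB1 _ _); last first.
    move=> i; rewrite divr_ge0 //= ler_pdivrMr ?ltr0n // mul1r ler_nat //.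
  have -> : m.*2%:R * d%:R / N%:R = \sum_(i < d) (m.*2%:R / N%:R) :> R.
    by rewrite sumr_const card_ord -[RHS]mulr_natr mulrAC.
  rewrite lerD2l lerN2.
  apply: ler_sum => i _; rewrite ler_wpM2l // lef_pV2 ?posrE ?ltr0n //.
  by rewrite ler_nat.
rewrite distrC ler_distl; apply/andP; split.
  by rewrite ler_pdivlMr // mulrC; apply: le_trans lo; rewrite ler_pM2l //; lra.
rewrite ler_pdivrMr //; apply: le_trans up _.
set P : R := (\prod_i (j i - m.*2))%:R in ratio *.
have KV : V * (K / N%:R) <= V * (e / 2).
  by rewrite ler_pM2l // ler_pdivrMr ?ltr0n.
have cF : V * H0 F <= V * (h + e / 2) by rewrite ler_pM2l // ltW.
have VP : (V - P) * H0 fset0 <= V * (K / N%:R).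
  rewrite /K mulrAC mulrA ler_wpM2r //.
  by move: ratio; rewrite mulrBr mulr1 !lerBlDr addrC.
apply: (le_trans (lerD cF (le_trans VP KV))).
by rewrite -mulrDr mulrC ler_pM2r //; lra.
Qed.

End EntropyAsInfimum.

(** * Both entropy bounds, from the infimum formula and the Markov property *)

Theorem lemma3p1 (R : realType) (d : nat) (hd : (1 <= d)%N) (A : alphabetType)
    (mu : probability (borel_config d A) R)
    (mu_stat : stationary mu) (mu_MRF : markov_random_field mu)
    (n : nat) (hn : (0 < n)%N) :
  cond_entropy mu [fset 0]%fset (fset_set (boundary (@Sn d n)))
    <= measure_entropy mu
    <= cond_entropy mu [fset 0]%fset (fset_set (@Un d n)).
Proof.
rewrite measure_entropy_inf //; apply/andP; split; last first.
  (* The sites of [Un n] lie in the boundary of [Pplus], hence outside [Pplus]. *)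
  apply: ge_inf; first exact: past_entropies_lbound.
  exists (fset_set (@Un d n)) => //= u.
  by rewrite in_fset_set ?inE; [case=> _ [] | exact: finite_Un].
have Sfin := @finite_Sn d n; have Bfin := finite_boundary Sfin.
apply: lb_le_inf; first by have [] := past_entropies_has_inf mu.
move=> _ [F Fpast <-].
set D := fset_set (boundary _).
have SK : boundary [set` fset_set (@Sn d n)] = boundary (@Sn d n).
  by rewrite fset_setK.
(* Adding [D] to [F] makes the Markov property applicable and can only lower the conditional
   entropy. *)
have DFD : (D `<=` F `|` D)%fset by exact: fsubsetUr.
have := @markov_cond_entropy R d A mu (fset_set (@Sn d n)) (F `|` D)%fset
  [fset 0]%fset mu_MRF.
rewrite SK -/D => /(_ DFD) <-.
- by apply: cond_entropy_mono; exact: fsubsetUl.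
(* [Sn n] lies in [Pplus], which [F] avoids, and a boundary is disjoint from its own set. *)
- apply/fdisjointP => u; rewrite in_fset_set // inE => uS /=.
  rewrite in_fsetU negb_or; apply/andP; split.
    by apply/negP => /Fpast; apply; have [] := uS.
  by rewrite in_fset_set //; apply/negP; rewrite inE => -[].
- rewrite fsub1set in_fset_set // inE; split; last exact: Pplus0.
  by move=> i; rewrite mxE oppr_le0.
Qed.
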